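(* For every integer $n \ge 4$, put $$\Delta(n) := \mathbf{E}[D] - \mathbf{E}[m] - \operatorname{Var}(m) - \frac{(4n-6)\,\mathbf{E}[m]^2}{n(n-1)} .$$ Then $$N_{\mathrm{dis}}(n)\,A(n) \le N_e(n)^2 \iff \Delta(n) \ge 0 ,$$ and equality $N_{\mathrm{dis}}(n)A(n) = N_e(n)^2$ holds exactly when $\Delta(n)=0$. Moreover, writing $\mu = \mathbf{E}[c]$ (so that $\mathbf{E}[m]=n-\mu$ and $\operatorname{Var}(m)=\operatorname{Var}(c)$), $$\Delta(n) = \big(\mathbf{E}[D]-5n\big) + 2 + 9\mu + \mu^2 - \mathbf{E}[c^2] - R(n,\mu), \qquad R(n,\mu) = \frac{(4\mu^2+4\mu-2)n-6\mu^2}{n(n-1)} .$$ If moreover $1 \le \mu \le 2$, then $0 < R(n,\mu) \le \dfrac{22}{n-1}$.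
   Context: $K_n$ is the simple complete graph on $[n]=\{1,\dots,n\}$. A forest of $K_n$ is an acyclic subset of its edge set (isolated vertices permitted, empty set included). $A(n)$ is the number of forests of $K_n$; $N_e(n)$ is the number of forests of $K_n$ containing one fixed edge; $N_{\mathrm{dis}}(n)$ is the number of forests of $K_n$ containing a fixed pair of disjoint edges (by symmetry these do not depend on the choice of edge or pair). For a forest $F$ of $K_n$: $c=c(F)$ is the number of components of the graph $([n],F)$, isolated vertices counted; $m=|F|=n-c$ is the number of edges; $D=D(F)=\sum_{v\in[n]}\deg_F(v)^2$. $\mathbf{E}$ and $\operatorname{Var}$ are taken with respect to the uniform measure on the $A(n)$ forests of $K_n$. *)

(* Defs.v *)
From HB Require Import structures.
From mathcomp Require Import all_boot all_order all_algebra.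

Set Implicit Arguments.
Unset Strict Implicit.
Unset Printing Implicit Defensive.

Import Order.TTheory GRing.Theory Num.Theory.
Local Open Scope ring_scope.

(* The vertex set [n] is 'I_n; an edge is a two-element set of vertices, and a
   spanning subgraph of K_n is identified with its edge set. *)
Definition complete_edges (n : nat) : {set {set 'I_n}} :=
  [set e : {set 'I_n} | #|e| == 2%N].

Definition adj (n : nat) (F : {set {set 'I_n}}) : rel 'I_n :=
  [rel x y | (x != y) && ([set x; y] \in F)].

(* No simple cycle x_1, ..., x_k (k >= 3, distinct vertices). The length is
   bounded by n only to make the predicate boolean; see acyclicP. *)
Definition acyclic (n : nat) (F : {set {set 'I_n}}) : bool :=
  ~~ [exists k : 'I_n.+1, [exists c : k.-tuple 'I_n,
        [&& (2 < k)%N, uniq c & cycle (adj F) c]]].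

Lemma acyclicP (n : nat) (F : {set {set 'I_n}}) :
  reflect (~ exists c : seq 'I_n, [/\ (2 < size c)%N, uniq c & cycle (adj F) c])
          (acyclic F).
Proof.
apply: (iffP idP) => [acF [c [c3 Uc Cc]] | noC].
  have ltk : (size c < n.+1)%N.
    by rewrite ltnS -{2}(card_ord n) -(card_uniqP Uc) max_card.
  case/negP: acF; apply/existsP; exists (Ordinal ltk).
  by apply/existsP; exists (in_tuple c); rewrite /= c3 Uc.
apply/negP => /existsP[k /existsP[c /and3P[k3 Uc Cc]]].
by case: noC; exists c; rewrite size_tuple.
Qed.

Definition forests (n : nat) : {set {set {set 'I_n}}} :=
  [set F : {set {set 'I_n}} | (F \subset complete_edges n) && acyclic F].

Definition num_forests (n : nat) : nat := #|forests n|.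

Definition num_forests_edge (n : nat) (e : {set 'I_n}) : nat :=
  #|[set F in forests n | e \in F]|.

Definition num_forests_pair (n : nat) (e1 e2 : {set 'I_n}) : nat :=
  #|[set F in forests n | (e1 \in F) && (e2 \in F)]|.

Definition components (n : nat) (F : {set {set 'I_n}}) : nat :=
  n_comp (adj F) 'I_n.

Definition degree (n : nat) (F : {set {set 'I_n}}) (v : 'I_n) : nat :=
  #|[set e in F | v \in e]|.

Definition sum_sq_degrees (n : nat) (F : {set {set 'I_n}}) : nat :=
  (\sum_(v : 'I_n) degree F v ^ 2)%N.

(* Expectation and variance for the uniform measure on the forests of K_n; all
   the averages involved are rational. *)
Definition expectation (n : nat) (X : {set {set 'I_n}} -> rat) : rat :=
  (\sum_(F in forests n) X F) / (num_forests n)%:R.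

Definition variance (n : nat) (X : {set {set 'I_n}} -> rat) : rat :=
  expectation (fun F => (X F - expectation X) ^+ 2).

Definition rv_edges (n : nat) (F : {set {set 'I_n}}) : rat := #|F|%:R.
Definition rv_components (n : nat) (F : {set {set 'I_n}}) : rat :=
  (components F)%:R.
Definition rv_sum_sq_degrees (n : nat) (F : {set {set 'I_n}}) : rat :=
  (sum_sq_degrees F)%:R.

Definition Delta (n : nat) : rat :=
  expectation (@rv_sum_sq_degrees n) - expectation (@rv_edges n)
  - variance (@rv_edges n)
  - (4%:R * n%:R - 6%:R) * expectation (@rv_edges n) ^+ 2
    / (n%:R * (n%:R - 1)).

Definition remainder (n : nat) (mu : rat) : rat :=
  ((4%:R * mu ^+ 2 + 4%:R * mu - 2%:R) * n%:R - 6%:R * mu ^+ 2)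
  / (n%:R * (n%:R - 1)).

(* Main.v *)
Require Import Defs.
From HB Require Import structures.
From mathcomp Require Import all_boot all_order all_algebra.
From mathcomp Require Import all_fingroup primitive_action alt.
From mathcomp Require Import ring lra zify.

Set Implicit Arguments.
Unset Strict Implicit.
Unset Printing Implicit Defensive.

Import Order.TTheory GRing.Theory Num.Theory.
Local Open Scope ring_scope.

(** The theorem rests on three facts about forests of K_n and on arithmetic.

    Counting pairs of edges.  Two edges e and f of a graph F satisfy
    [e disjoint from f] + |e :&: f| = 1 + [e = f], because they share 0, 1 or 2
    vertices, the last only when they coincide.  Summed over all ordered pairs
    of edges of F, the intersections contribute D(F), since a vertex v lies in
    deg(v)^2 of them.  So dis(F) + D(F) = m^2 + m, where dis(F) is the number of
    ordered pairs of disjoint edges of F ([sum_disjoint_edges]).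

    Symmetry.  Permutations of the vertices act on forests, and they move any
    edge, or any pair of disjoint edges, to any other.  Counting incidences
    between forests and edges therefore gives E[m] = C(n,2) N_e / A, and
    counting incidences with ordered pairs of disjoint edges gives
    E[dis] = C(n,2) C(n-2,2) N_dis / A.  Since
    C(n-2,2) / C(n,2) = 1 - (4n-6)/(n(n-1)), substituting
    E[D] = E[m^2] + E[m] - E[dis] in the definition of Delta yields
      Delta = C(n,2) C(n-2,2) / A^2 * (N_e^2 - N_dis A)
    ([Delta_forest_counts]), whose first factor is positive for n >= 4: hence
    the equivalences.

    Components.  A forest satisfies m + c = n ([card_forest_components]): the
    deletion of an edge xy of an acyclic graph disconnects x from y, since a
    simple path avoiding xy would close up into a cycle, and it changes nothing
    outside of the component of x and y.  Substituting m = n - c turns the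
    definition of Delta into the formula in terms of mu; the bounds on the
    remainder are elementary. *)

(** * Sums over edges *)

Lemma complete_edgesP (n : nat) (e : {set 'I_n}) :
  reflect (exists x y, x != y /\ e = [set x; y]) (e \in complete_edges n).
Proof. by rewrite inE; apply: cards2P. Qed.

Lemma forest_edges (n : nat) (F : {set {set 'I_n}}) :
  F \in forests n -> F \subset complete_edges n.
Proof. by rewrite inE => /andP[]. Qed.

Lemma sum_indicator (T : finType) (A : {pred T}) (P : pred T) :
  (\sum_(x in A) P x)%N = #|[set x in A | P x]|.
Proof. by rewrite -sum1dep_card -big_mkcondr. Qed.

(** Spreads a sum over the edges of a graph to all edges of K_n, so that the
    range of summation no longer depends on the graph and the order of
    summation can be exchanged. *)
Lemma sum_over_superset (T : finType) (A B : {set T}) (G : T -> nat) :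
  A \subset B -> (\sum_(x in A) G x = \sum_(x in B) (x \in A) * G x)%N.
Proof.
move=> /subsetP sAB; rewrite big_mkcond [RHS]big_mkcond.
apply: eq_bigr => x _; case: ifPn => [/sAB -> | _]; first by rewrite mul1n.
by case: ifP.
Qed.

(** Both sides sum over the ordered pairs of edges of [F] the weight 2 for equal
    edges and 1 for distinct ones: distinct edges are either disjoint or share
    exactly one vertex. *)
Lemma sum_disjoint_edges (n : nat) (F : {set {set 'I_n}}) :
  F \subset complete_edges n ->
  (\sum_(e in F) \sum_(f in F) [disjoint e & f] + sum_sq_degrees F
   = #|F| ^ 2 + #|F|)%N.
Proof.
move=> sFK.
have -> : (sum_sq_degrees F = \sum_(e in F) \sum_(f in F) #|e :&: f|)%N.
  have deg v : (degree F v = \sum_(e in F) (v \in e))%N.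
    by rewrite /degree -sum1dep_card -big_mkcondr.
  transitivity (\sum_(v : 'I_n) \sum_(e in F) \sum_(f in F)
      (v \in e) * (v \in f))%N.
    rewrite /sum_sq_degrees; apply: eq_bigr => v _.
    by rewrite deg -mulnn big_distrlr.
  rewrite [LHS]exchange_big; apply: eq_bigr => e _.
  rewrite [LHS]exchange_big; apply: eq_bigr => f _.
  rewrite -sum1_card [RHS]big_mkcond; apply: eq_bigr => v _.
  by rewrite inE; case: (v \in e); case: (v \in f).
have cardF2 : (#|F| ^ 2 = \sum_(e in F) \sum_(f in F) 1)%N.
  by under eq_bigr do rewrite sum1_card; rewrite sum_nat_const.
have cardF : (#|F| = \sum_(e in F) \sum_(f in F) (e == f))%N.
  rewrite -sum1_card; apply: eq_bigr => e Fe.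
  rewrite (bigD1 e) //= eqxx big1 ?addn0 // => f /andP[_ /negPf].
  by rewrite eq_sym => ->.
rewrite cardF2 cardF -!big_split /=.
apply: eq_bigr => e Fe; rewrite -!big_split /=; apply: eq_bigr => f Ff.
have := subsetP sFK _ Fe; have := subsetP sFK _ Ff.
rewrite !inE => /eqP cf /eqP ce; rewrite -setI_eq0 -cards_eq0.
have le2 : (#|e :&: f| <= 2)%N by rewrite -ce subset_leq_card ?subsetIl.
have -> : (e == f) = (#|e :&: f| == 2).
  rewrite eqEcard ce cf leqnn andbT; apply/setIidPl/eqP => [-> // | cI].
  by apply/eqP; rewrite eqEcard subsetIl cI ce.
by case: #|_| le2 => [|[|[|]]].
Qed.

(** * Symmetry of the complete graph *)

Definition relabel (n : nat) (s : {perm 'I_n}) (F : {set {set 'I_n}}) :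
    {set {set 'I_n}} :=
  [set s @: e | e : {set 'I_n} in F].

Lemma relabel_inj (n : nat) (s : {perm 'I_n}) : injective (relabel s).
Proof. exact/imset_inj/imset_inj/perm_inj. Qed.

Lemma mem_relabel (n : nat) (s : {perm 'I_n}) (F : {set {set 'I_n}})
    (e : {set 'I_n}) :
  (s @: e \in relabel s F) = (e \in F).
Proof. exact/mem_imset/imset_inj/perm_inj. Qed.

Lemma adj_relabel (n : nat) (s : {perm 'I_n}) (F : {set {set 'I_n}}) x y :
  adj (relabel s F) (s x) (s y) = adj F x y.
Proof.
by rewrite /adj /= (inj_eq perm_inj) -(mem_relabel s F) imsetU1 imset_set1.
Qed.

Lemma relabel_forest (n : nat) (s : {perm 'I_n}) (F : {set {set 'I_n}}) :
  F \in forests n -> relabel s F \in forests n.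
Proof.
rewrite !inE => /andP[/subsetP sFK /acyclicP acF]; apply/andP; split.
  apply/subsetP=> _ /imsetP[e /sFK eK ->].
  by move: eK; rewrite !inE card_imset //; apply: perm_inj.
apply/acyclicP=> -[c [c3 Uc Cc]]; apply: acF.
have sK : map s (map (s^-1)%g c) = c by apply: mapK; apply: permKV.
exists (map (s^-1)%g c); split.
- by rewrite size_map.
- by rewrite map_inj_uniq //; apply: perm_inj.
rewrite -sK cycle_map in Cc.
have adjE : relpre s (adj (relabel s F)) =2 adj F by apply: adj_relabel.
by rewrite (eq_cycle adjE) in Cc.
Qed.

(** Relabelling is injective, which gives an inequality for each permutation;
    used in both directions between two orbit members, it gives equality of
    the counts. *)
Lemma num_forests_pair_relabel (n : nat) (s : {perm 'I_n}) (e f : {set 'I_n}) :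
  (num_forests_pair e f <= num_forests_pair (s @: e) (s @: f))%N.
Proof.
rewrite /num_forests_pair -(card_imset _ (@relabel_inj n s)).
apply: subset_leq_card.
apply/subsetP=> _ /imsetP[F /setIdP[FF efF] ->].
by apply/setIdP; split; [exact: relabel_forest | rewrite !mem_relabel].
Qed.


(** The symmetric group of [T] is #|T|-fold transitive, hence k-fold transitive
    for every smaller k. *)
Lemma perm_of_uniq_tuples (T : finType) (k : nat) (t u : k.-tuple T) :
  uniq t -> uniq u -> exists s : {perm T}, map s t = u.
Proof.
move=> Ut Uu.
have lekT : (k <= #|T|)%N by rewrite -(size_tuple t) -(card_uniqP Ut) max_card.
have trT := ntransitive_weak lekT (Sym_trans T).
have onT (w : k.-tuple T) : uniq w -> w \in dtuple_on k setT.
  by move=> Uw; rewrite inE Uw; apply/subsetP.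
by have [s _ ->] := atransP2 trT (onT t Ut) (onT u Uu); exists s.
Qed.

(** The count is invariant because the symmetric group is 2-transitive; an edge
    is treated as the degenerate pair made of that edge taken twice. *)
Lemma num_forests_edge_eq (n : nat) (e e' : {set 'I_n}) :
  e \in complete_edges n -> e' \in complete_edges n ->
  num_forests_edge e = num_forests_edge e'.
Proof.
have edge_pair f : num_forests_edge f = num_forests_pair f f.
  by apply: eq_card => F; rewrite !inE andbb.
suff le_num (f f' : {set 'I_n}) :
    f \in complete_edges n -> f' \in complete_edges n ->
    (num_forests_edge f <= num_forests_edge f')%N.
  by move=> eK eK'; apply/eqP; rewrite eqn_leq !le_num.
move=> /complete_edgesP[x [y [xy ->]]] /complete_edgesP[x' [y' [xy' ->]]].
have [||s [sx sy]] := @perm_of_uniq_tuples _ 2 [tuple x; y] [tuple x'; y'].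
- by rewrite /= inE xy.
- by rewrite /= inE xy'.
have := num_forests_pair_relabel s [set x; y] [set x; y].
by rewrite imsetU1 imset_set1 sx sy -!edge_pair.
Qed.

Lemma disjoint_edges_uniq (T : finType) (x y z t : T) :
  x != y -> z != t -> [disjoint [set x; y] & [set z; t]] ->
  uniq [:: x; y; z; t].
Proof.
move=> xy zt; rewrite disjoints_subset subUset !sub1set /= !inE => /andP[xN yN].
by rewrite !negb_or xy zt -!negb_or xN yN.
Qed.

(** Two disjoint edges have four distinct endpoints, and the symmetric group is
    4-transitive. *)
Lemma num_forests_pair_eq (n : nat) (e f e' f' : {set 'I_n}) :
  e \in complete_edges n -> f \in complete_edges n -> [disjoint e & f] ->
  e' \in complete_edges n -> f' \in complete_edges n -> [disjoint e' & f'] ->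
  num_forests_pair e f = num_forests_pair e' f'.
Proof.
suff le_num (a b c d : {set 'I_n}) :
    a \in complete_edges n -> b \in complete_edges n -> [disjoint a & b] ->
    c \in complete_edges n -> d \in complete_edges n -> [disjoint c & d] ->
    (num_forests_pair a b <= num_forests_pair c d)%N.
  by move=> *; apply/eqP; rewrite eqn_leq !le_num.
move=> /complete_edgesP[x [y [xy ->]]] /complete_edgesP[z [t [zt ->]]] dis.
move=> /complete_edgesP[x' [y' [xy' ->]]] /complete_edgesP[z' [t' [zt' ->]]].
move=> dis'.
have [||s [sx sy sz st]] :=
  @perm_of_uniq_tuples _ 4 [tuple x; y; z; t] [tuple x'; y'; z'; t'].
- exact: disjoint_edges_uniq.
- exact: disjoint_edges_uniq.
have := num_forests_pair_relabel s [set x; y] [set z; t].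
by rewrite !imsetU1 !imset_set1 sx sy sz st.
Qed.

(** * Double counting *)

(** Counts the incidences between forests and edges; all the edges of K_n
    contribute equally, by symmetry. *)
Lemma sum_forest_edges (n : nat) (e : {set 'I_n}) :
  e \in complete_edges n ->
  (\sum_(F in forests n) #|F| = 'C(n, 2) * num_forests_edge e)%N.
Proof.
move=> eK.
transitivity (\sum_(F in forests n) \sum_(f in complete_edges n) (f \in F))%N.
  apply: eq_bigr => F /forest_edges sFK.
  rewrite -sum1_card (sum_over_superset _ sFK).
  by apply: eq_bigr => f _; rewrite muln1.
rewrite exchange_big /=.
transitivity (\sum_(f in complete_edges n) num_forests_edge e)%N.
  by apply: eq_bigr => f fK; rewrite -(num_forests_edge_eq fK eK) sum_indicator.
by rewrite sum_nat_const card_draws card_ord.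
Qed.

Lemma card_disjoint_edges (n : nat) (e : {set 'I_n}) :
  e \in complete_edges n ->
  #|[set f in complete_edges n | [disjoint e & f]]| = 'C(n - 2, 2).
Proof.
rewrite inE => /eqP ce.
have <- : #|~: e| = (n - 2)%N by rewrite cardsCs setCK card_ord ce.
rewrite -cards_draws; apply: eq_card => f.
by rewrite !inE andbC disjoint_sym disjoints_subset.
Qed.

(** Counts the incidences between forests and ordered pairs of disjoint edges.
    K_n has C(n,2) C(n-2,2) such pairs, the second edge being chosen among the
    n - 2 vertices off the first, and they contribute equally by symmetry. *)
Lemma sum_forest_disjoint_edges (n : nat) (e1 e2 : {set 'I_n}) :
  e1 \in complete_edges n -> e2 \in complete_edges n ->
  [disjoint e1 & e2] ->
  (\sum_(F in forests n) \sum_(e in F) \sum_(f in F) [disjoint e & f]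
   = 'C(n, 2) * ('C(n - 2, 2) * num_forests_pair e1 e2))%N.
Proof.
move=> e1K e2K dis.
transitivity (\sum_(F in forests n) \sum_(e in complete_edges n)
    \sum_(f in complete_edges n | [disjoint e & f])
      ((e \in F) && (f \in F)))%N.
  apply: eq_bigr => F /forest_edges sFK.
  rewrite (sum_over_superset _ sFK); apply: eq_bigr => e _.
  rewrite (sum_over_superset _ sFK) big_distrr /= big_mkcondr.
  apply: eq_bigr => f _.
  by case: (e \in F); case: (f \in F); case: [disjoint e & f].
rewrite exchange_big /=.
transitivity (\sum_(e in complete_edges n)
    'C(n - 2, 2) * num_forests_pair e1 e2)%N; last first.
  by rewrite sum_nat_const card_draws card_ord.
apply: eq_bigr => e eK; rewrite exchange_big /= -(card_disjoint_edges eK).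
rewrite -sum_nat_cond_const; apply: eq_bigr => f /andP[fK ef].
by rewrite -(num_forests_pair_eq eK fK ef e1K e2K dis) sum_indicator.
Qed.

(** * Components of a forest *)

Lemma adj_sym (n : nat) (F : {set {set 'I_n}}) : symmetric (adj F).
Proof. by move=> x y; rewrite /adj /= eq_sym setUC. Qed.

Lemma connect_adj_sym (n : nat) (F : {set {set 'I_n}}) : connect_sym (adj F).
Proof. exact/sym_connect_sym/adj_sym. Qed.

Lemma set2_eq (T : finType) (x y u v : T) :
  [set u; v] = [set x; y] -> (u == x) && (v == y) || (u == y) && (v == x).
Proof.
move=> E; have := set21 u v; have := set22 u v; rewrite E !inE.
have := set21 x y; have := set22 x y; rewrite -E !inE.
rewrite (eq_sym x) (eq_sym x) (eq_sym y) (eq_sym y).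
by case: (u == x); case: (u == y); case: (v == x); case: (v == y).
Qed.

Lemma acyclic_sub (n : nat) (F G : {set {set 'I_n}}) :
  F \subset G -> acyclic G -> acyclic F.
Proof.
move=> /subsetP sFG /acyclicP acG; apply/acyclicP=> -[c [c3 Uc Cc]]; apply: acG.
exists c; split=> //; apply: sub_cycle Cc => x y /andP[xy /sFG xyG].
exact/andP.
Qed.

(** A path from [x] to [y] that avoids the edge [xy] can be made simple; it has
    at least two edges, so that together with [xy] it forms a cycle. *)
Lemma acyclic_disconnect (n : nat) (F : {set {set 'I_n}}) (x y : 'I_n) :
  x != y -> [set x; y] \in F -> acyclic F ->
  ~~ connect (adj (F :\ [set x; y])) x y.
Proof.
move=> xy xyF /acyclicP acF; apply/negP=> /connectP[p pP].
case/shortenP: pP => {}p pP Up _ def_y; apply: acF.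
have adjW : subrel (adj (F :\ [set x; y])) (adj F).
  by move=> u v /andP[uv /setD1P[_ uvF]]; apply/andP.
exists (x :: p); split=> //.
- case: p pP Up def_y => [|z [|t p]] //= pP _ def_y.
    by rewrite def_y eqxx in xy.
  by move: pP; rewrite /adj /= -def_y !inE eqxx andbF.
rewrite /= rcons_path -def_y (sub_path adjW pP) /=.
by rewrite /adj /= eq_sym xy setUC.
Qed.

(** Cut the vertex set along the union [a] of the components of [x] and [y] in
    the graph without the edge [xy]. Both graphs respect this cut. They agree
    outside of [a], whereas [a] is made of two components without the edge and
    of a single one with it. *)
Lemma components_delete_edge (n : nat) (F : {set {set 'I_n}}) (x y : 'I_n) :
  x != y -> [set x; y] \in F -> acyclic F ->
  components (F :\ [set x; y]) = (components F).+1.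
Proof.
move=> xy xyF acF; set F' := F :\ [set x; y].
pose a := closure (adj F') (pred2 x y).
have symF' := @connect_adj_sym n F'; have symF := @connect_adj_sym n F.
have xa : x \in a by apply: mem_closure; rewrite !inE eqxx.
have ya : y \in a by apply: mem_closure; rewrite !inE eqxx orbT.
have adjF u v : adj F u v ->
    adj F' u v \/ (u \in [:: x; y]) && (v \in [:: x; y]).
  move=> /andP[uv uvF]; have [E|ne] := eqVneq [set u; v] [set x; y].
    right; rewrite !inE.
    by case/orP: (set2_eq E) => /andP[/eqP-> /eqP->]; rewrite !eqxx ?orbT.
  by left; rewrite /adj /= uv in_setD1 ne.
have adjF' u v : adj F' u v -> adj F u v.
  by move=> /andP[uv /setD1P[_ uvF]]; apply/andP.
have cl' : closed (adj F') a by apply: closure_closed.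
have in_a u : u \in [:: x; y] -> u \in a.
  by rewrite !inE => /orP[] /eqP->.
have cl : closed (adj F) a.
  apply: (intro_closed symF) => u v /adjF[/cl' -> // | /andP[_ /in_a //]].
have a1 : a =i connect (adj F) x.
  move=> u; apply/idP/idP => [|cxu]; last by rewrite -(closed_connect cl cxu).
  case/existsP=> /= v /andP[/= uv].
  have cuv: connect (adj F) v u.
    rewrite symF; apply: connect_sub uv => s t /adjF'; exact: connect1.
  rewrite !inE => /orP[] /eqP E; rewrite E in cuv => //.
  by apply: connect_trans cuv; apply: connect1; rewrite /adj /= xy.
rewrite /components (n_compC a) [in RHS](n_compC a).
rewrite (n_comp_closure2 symF') acyclic_disconnect //.
rewrite (eq_n_comp_r a1) (n_comp_connect symF) -[in RHS]addSn; congr (2 + _)%N.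
apply: (@adjunction_n_comp _ _ id) => //; first exact: predC_closed.
apply: strict_adjunction => //; first exact: predC_closed.
  by apply/subsetP=> u _; apply/codomP; exists u.
move=> u v; rewrite !inE negbK => ua; apply/idP/idP => [/adjF' //|].
by case/adjF => // /andP[/in_a]; rewrite (negPf ua).
Qed.

(** Deleting the edges one at a time, each deletion creates one component, until
    the [n] isolated vertices remain. *)
Lemma card_forest_components (n : nat) (F : {set {set 'I_n}}) :
  F \in forests n -> (#|F| + components F = n)%N.
Proof.
rewrite inE; move: {2}#|F| (erefl #|F|) => m.
elim: m F => [|m IHm] F cF /andP[sFK acF].
  have F0 : F = set0 by apply: cards0_eq.
  rewrite cF add0n -[RHS]card_ord; apply: eq_card => u.
  rewrite !inE andbT; apply/eqP.
  have [p] := connectP (connect_root (adj F) u).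
  case: p => [_ -> //|v p /andP[/andP[_]]].
  by rewrite F0 inE.
have [e eF] : exists e, e \in F by apply/set0Pn; rewrite -card_gt0 cF.
have /complete_edgesP[x [y [xy def_e]]] := subsetP sFK _ eF.
have cFe : #|F :\ e| = m by move: (cardsD1 e F); rewrite cF eF => -[].
rewrite cF addSnnS -cFe def_e -(components_delete_edge xy) -?def_e //.
apply: IHm => //; apply/andP; split.
  exact: subset_trans (subD1set _ _) sFK.
exact: acyclic_sub (subD1set _ _) acF.
Qed.

(** * Expectations over forests *)

Lemma num_forests_gt0 (n : nat) : (0 < num_forests n)%N.
Proof.
apply/card_gt0P; exists set0; rewrite inE sub0set; apply/acyclicP=> -[c []].
by case: c => [|u [|v c]] //= _ _ /andP[/andP[_]]; rewrite inE.
Qed.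

Lemma expectation_ext (n : nat) (X Y : {set {set 'I_n}} -> rat) :
  {in forests n, X =1 Y} -> expectation X = expectation Y.
Proof. by move=> eXY; congr (_ / _); apply: eq_bigr. Qed.

Lemma expectationD (n : nat) (X Y : {set {set 'I_n}} -> rat) :
  expectation (fun F => X F + Y F) = expectation X + expectation Y.
Proof. by rewrite /expectation big_split mulrDl. Qed.

Lemma expectationZ (n : nat) (a : rat) (X : {set {set 'I_n}} -> rat) :
  expectation (fun F => a * X F) = a * expectation X.
Proof. by rewrite /expectation -big_distrr mulrA. Qed.

Lemma expectation_cst (n : nat) (a : rat) :
  expectation (fun _ : {set {set 'I_n}} => a) = a.
Proof.
rewrite /expectation sumr_const -[a *+ _]mulr_natr mulfK //.
by rewrite pnatr_eq0 -lt0n num_forests_gt0.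
Qed.

Lemma expectation_nat (n : nat) (X : {set {set 'I_n}} -> nat) :
  expectation (fun F => (X F)%:R) =
  (\sum_(F in forests n) X F)%N%:R / (num_forests n)%:R.
Proof. by rewrite /expectation natr_sum. Qed.

Lemma varianceE (n : nat) (X : {set {set 'I_n}} -> rat) :
  variance X = expectation (fun F => X F ^+ 2) - expectation X ^+ 2.
Proof.
rewrite /variance; set m := expectation X.
transitivity (expectation (fun F => X F ^+ 2 + (- 2%:R * m * X F + m ^+ 2))).
  by apply: expectation_ext => F _; ring.
by rewrite !expectationD expectationZ expectation_cst -/m; ring.
Qed.

Lemma natr_bin2 (n : nat) : 'C(n, 2)%:R = n%:R * (n%:R - 1) / 2%:R :> rat.
Proof.
have := congr1 (fun k => k%:R : rat) (bin_ffact n 2).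
case: n => [|n]; first by rewrite bin0n !mul0r.
rewrite ffactnS ffactn1 /= !natrM => binE.
have -> : n.+1%:R - 1 = n%:R :> rat by rewrite -natr1 addrK.
by rewrite -binE mulfK.
Qed.

(** * Delta in terms of forest counts *)

(** [Delta] is a positive multiple of the correlation defect
    N_e^2 - N_dis A. The identity between ordered pairs of edges trades E[D] for
    the expected number of ordered pairs of disjoint edges, and the coefficient
    (4n-6)/(n(n-1)) is exactly 1 - C(n-2,2) / C(n,2). *)
Lemma Delta_forest_counts (n : nat) (e e1 e2 : {set 'I_n}) :
  (4 <= n)%N -> e \in complete_edges n -> e1 \in complete_edges n ->
  e2 \in complete_edges n -> [disjoint e1 & e2] ->
  Delta n = ('C(n, 2) * 'C(n - 2, 2))%N%:R / (num_forests n)%:R ^+ 2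
    * ((num_forests_edge e ^ 2)%N%:R
       - (num_forests_pair e1 e2 * num_forests n)%N%:R).
Proof.
move=> n4 eK e1K e2K dis.
have Em : expectation (@rv_edges n) =
    'C(n, 2)%:R * (num_forests_edge e)%:R / (num_forests n)%:R.
  by rewrite expectation_nat (sum_forest_edges eK) natrM.
pose X (F : {set {set 'I_n}}) : rat :=
  (\sum_(f in F) \sum_(g in F) [disjoint f & g])%N%:R.
have EX : expectation X = 'C(n, 2)%:R * 'C(n - 2, 2)%:R *
    (num_forests_pair e1 e2)%:R / (num_forests n)%:R.
  rewrite expectation_nat (sum_forest_disjoint_edges e1K e2K dis).
  by rewrite !natrM mulrA.
have EXD : expectation X + expectation (@rv_sum_sq_degrees n) =
    expectation (fun F => @rv_edges n F ^+ 2) + expectation (@rv_edges n).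
  rewrite -!expectationD; apply: expectation_ext => F /forest_edges sFK.
  by rewrite /X /rv_edges -natrX -!natrD sum_disjoint_edges.
rewrite /Delta varianceE.
have -> : expectation (@rv_sum_sq_degrees n) =
    expectation (fun F => @rv_edges n F ^+ 2) + expectation (@rv_edges n)
    - expectation X by rewrite -EXD; ring.
rewrite EX Em natrM natrX natrM !natr_bin2 natrB; last by lia.
have A0 : (num_forests n)%:R != 0 :> rat.
  by rewrite pnatr_eq0 -lt0n num_forests_gt0.
have n0 : n%:R != 0 :> rat by rewrite pnatr_eq0; lia.
have n1 : n%:R - 1 != 0 :> rat by rewrite subr_eq0 pnatr_eq1; lia.
by field; rewrite A0 n0 n1.
Qed.

(** After clearing denominators, both bounds concern the coefficient
    4 mu^2 + 4 mu - 2 of n, which lies between 6 and 22 when 1 <= mu <= 2. The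
    upper bound drops -6 mu^2; the lower one absorbs it using n >= 4. *)
Lemma remainder_bounds (n : nat) (mu : rat) :
  (4 <= n)%N -> 1 <= mu <= 2%:R ->
  0 < remainder n mu /\ remainder n mu <= 22%:R / (n%:R - 1).
Proof.
move=> n4 /andP[mu1 mu2].
have N4 : 4%:R <= n%:R :> rat by rewrite ler_nat.
have N0 : 0 < n%:R :> rat by lra.
have N1 : 0 < n%:R - 1 :> rat by lra.
have sq1 : 1 <= mu ^+ 2 by rewrite exprn_ege1.
have sq4 : mu ^+ 2 <= 4%:R by nra.
rewrite /remainder; split.
  apply: divr_gt0; last exact: mulr_gt0.
  have coef_ge0 : 0 <= 4%:R * mu ^+ 2 + 4%:R * mu - 2%:R by lra.
  have := ler_wpM2l coef_ge0 N4; lra.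
rewrite ler_pdivrMr ?mulr_gt0 //.
have -> : 22%:R / (n%:R - 1) * (n%:R * (n%:R - 1)) = 22%:R * n%:R :> rat.
  by field; rewrite gt_eqF.
have coef_le : 4%:R * mu ^+ 2 + 4%:R * mu - 2%:R <= 22%:R by lra.
have := ler_wpM2r (ltW N0) coef_le; lra.
Qed.

Theorem proposition3p1 (n : nat) (n_ge4 : (4 <= n)%N) :
  (forall e e1 e2 : {set 'I_n},
     e \in complete_edges n -> e1 \in complete_edges n ->
     e2 \in complete_edges n -> [disjoint e1 & e2] ->
     ((num_forests_pair e1 e2 * num_forests n <= num_forests_edge e ^ 2)%N
        <-> 0 <= Delta n)
     /\ ((num_forests_pair e1 e2 * num_forests n)%N = (num_forests_edge e ^ 2)%N
        <-> Delta n = 0))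
  /\ (let mu := expectation (@rv_components n) in
      [/\ expectation (@rv_edges n) = n%:R - mu,
          variance (@rv_edges n) = variance (@rv_components n),
          Delta n =
            (expectation (@rv_sum_sq_degrees n) - 5%:R * n%:R) + 2%:R
            + 9%:R * mu + mu ^+ 2
            - expectation (fun F : {set {set 'I_n}} => rv_components F ^+ 2)
            - remainder n mu
        & 1 <= mu <= 2%:R ->
            0 < remainder n mu /\ remainder n mu <= 22%:R / (n%:R - 1)]).
Proof.
split=> [e e1 e2 eK e1K e2K dis | mu].
  rewrite (Delta_forest_counts n_ge4 eK e1K e2K dis).
  set c := _ / _; have c_gt0 : 0 < c.
    rewrite divr_gt0 ?exprn_gt0 ?ltr0n ?num_forests_gt0 //.
    by rewrite muln_gt0 !bin_gt0; lia.
  split; first by rewrite pmulr_rge0 // subr_ge0 ler_nat.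
  split=> [-> | /eqP]; first by rewrite subrr mulr0.
  by rewrite mulf_eq0 gt_eqF //= subr_eq0 eqr_nat => /eqP.
have edgesE F : F \in forests n -> rv_edges F = n%:R + -1 * rv_components F.
  by move/card_forest_components=> {2}<-; rewrite natrD mulN1r addrK.
have Em : expectation (@rv_edges n) = n%:R - mu.
  rewrite (expectation_ext edgesE) expectationD expectation_cst.
  by rewrite expectationZ mulN1r.
have Vm : variance (@rv_edges n) = variance (@rv_components n).
  apply: expectation_ext => F FF; rewrite Em (edgesE F FF) -/mu; ring.
split=> //; last exact: remainder_bounds.
rewrite /Delta Vm varianceE Em -/mu /remainder.
have n0 : n%:R != 0 :> rat by rewrite pnatr_eq0; lia.
have n1 : n%:R - 1 != 0 :> rat by rewrite subr_eq0 pnatr_eq1; lia.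
by field; rewrite n0 n1.
Qed.
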